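(* Consider converter $i$ in either PQ or PV control mode, with $2\times2$ admittance matrix $\mathbf Y_{\mathrm C,i}(s,\mathcal O_i)$ at operating point $\mathcal O_i=[P_i,Q_i,V_i]^\top$, and let $$\underline x_i(\omega,\mathcal O_i)=\min_{(x,z)\in P_{xz}(\mathbf Y_{\mathrm C,i}(j\omega,\mathcal O_i)\mathbf F_\epsilon^{-1}(j\omega))}x=\min_{\|v\|_2=1}\Re\left(v^*\,\mathbf Y_{\mathrm C,i}(j\omega,\mathcal O_i)\,\mathbf F_\epsilon^{-1}(j\omega)\,v\right)$$ be the leftmost $x$-value of its $x$-$z$ graph. Then, for any fixed $V_i$ and $\omega\in[0,\infty)$: (i) $\underline x_i(\omega,\mathcal O_i)$ is concave with respect to $(P_i,Q_i)$. (ii) For any nonempty compact region $\mathcal U_i\subset\mathbb R^2$ of power injections with $\mathcal U_i\times\{V_i\}\subset\bar{\mathcal S}_i$, the minimum of $\underline x_i$ over $\mathcal U_i$ is attained on its boundary $\partial\mathcal U_i$, i.e. $$\min_{(P_i,Q_i)\in\mathcal U_i}\underline x_i(\omega,\mathcal O_i)=\min_{(P_i,Q_i)\in\partial\mathcal U_i}\underline x_i(\omega,\mathcal O_i).$$ (iii) For any family $\{\mathcal U_i(\rho)\}_{\rho\ge0}$ of nonempty compact regions of power injections satisfying $\mathcal U_i(\rho_1)\subseteq\mathcal U_i(\rho_2)$ for $0\le\rho_1<\rho_2$, the boundary minimum is non-increasing in $\rho$: for $0\le\rho_1<\rho_2$, $$\min_{(P_i,Q_i)\in\partial\mathcal U_i(\rho_2)}\underline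 x_i(\omega,\mathcal O_i)\le\min_{(P_i,Q_i)\in\partial\mathcal U_i(\rho_1)}\underline x_i(\omega,\mathcal O_i).$$
   Context: Operating points: $\mathcal O_i=[P_i,Q_i,V_i]^\top\in\mathbb R^3$ with $P_i$ active power, $Q_i$ reactive power, $V_i>0$ voltage magnitude. The admissible set is $\bar{\mathcal S}_i=\{\mathcal O_i: P_i^2+Q_i^2\le\kappa_i^2,\ \angle(P_i+\mathrm jQ_i)\in\Psi_i,\ V_i\in\mathcal V_i\}$ for given $\kappa_i$, angle range $\Psi_i$ and voltage set $\mathcal V_i$. The $x$-$z$ graph of $A\in\mathbb C^{n\times n}$ is $P_{xz}(A)=\{(\Re(v^*Av),\|Av\|^2): v\in\mathbb C^n,\|v\|=1\}\subset\mathbb R^2$, where $v^*$ is the conjugate transpose. Network factor: $\mathbf F_\epsilon^{-1}(s)=\begin{bmatrix}s/\omega_0+\epsilon&-1\\1&s/\omega_0+\epsilon\end{bmatrix}$, with $\omega_0>0$ the nominal frequency and $\epsilon$ the network R/X ratio (independent of the operating point). Converter admittance: let $G_I(s)$, $Y_{VF}(s)$, $\mathrm{PI}_{AC}(s)$, $\mathrm{PI}_{RC}(s)$, $\mathrm{PI}_{VC}(s)$, $\mathrm{PI}_{PLL}(s)$ be given scalar rational transfer functions of converter $i$, independent of the operating point (current-loop tracking, voltage feedforward, and the active-power, reactive-power, voltage and PLL PI controllers). Put $D_p=1+G_I\,\mathrm{PI}_{AC}V_i$, $D_q=1+G_I\,\mathrm{PI}_{RC}V_i$, $S=s+\mathrm{PI}_{PLL}V_i$,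 and $\mathbf Y_F(s)=\frac{C_F}{\omega_0}\begin{bmatrix}s&-\omega_0\\\omega_0&s\end{bmatrix}$ with $C_F$ the filter capacitance. Omitting the argument $s$, in PQ mode $$\mathbf Y_{\mathrm C,i}=\begin{bmatrix}\dfrac{G_I\mathrm{PI}_{AC}P_i+V_iY_{VF}}{V_iD_p}&-\dfrac{Q_i[sG_I\mathrm{PI}_{AC}+\mathrm{PI}_{PLL}D_p]}{V_iD_pS}\\[2mm]-\dfrac{Q_iG_I\mathrm{PI}_{RC}}{V_iD_q}&\dfrac{sV_iY_{VF}-P_i[sG_I\mathrm{PI}_{RC}+\mathrm{PI}_{PLL}D_q]}{V_iSD_q}\end{bmatrix}+\mathbf Y_F,$$ and in PV mode $$\mathbf Y_{\mathrm C,i}=\begin{bmatrix}\dfrac{G_I\mathrm{PI}_{AC}P_i+V_iY_{VF}}{V_iD_p}&-\dfrac{Q_i[sG_I\mathrm{PI}_{AC}+\mathrm{PI}_{PLL}D_p]}{V_iD_pS}\\[2mm]-G_I\mathrm{PI}_{VC}&\dfrac{sV_iY_{VF}-\mathrm{PI}_{PLL}P_i}{V_iS}\end{bmatrix}+\mathbf Y_F.$$ For fixed $V_i$, each entry is a combination of $1,P_i,Q_i$ with coefficients that are rational functions of $s$. Evaluation at $s=j\omega$ means evaluation of these rational functions (after cancellation), which are assumed to be well defined and to have no pole at $s=j\omega$. *)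

(* Defs.v *)
(* Mathematical Components with MathComp-Analysis; complex numbers are R[i]
   over an arbitrary R : realType. *)
From HB Require Import structures.
From mathcomp Require Export all_boot all_order all_algebra.
From mathcomp Require Export all_classical all_reals all_analysis.
From mathcomp Require Export complex.

Set Implicit Arguments.
Unset Strict Implicit.
Unset Printing Implicit Defensive.

Import Order.TTheory GRing.Theory Num.Theory.
Import numFieldNormedType.Exports.

Local Open Scope classical_set_scope.
Local Open Scope ring_scope.
Local Open Scope complex_scope.
Local Open Scope convex_scope.
Local Open Scope sesquilinear_scope.

Local Notation "x %:F" := (@FracField.tofrac _ x).

(* The boundary in the topology of T, relative to the whole space. *)
Definition boundary (T : topologicalType) (A : set T) : set T :=
  closure A `\` interior A.

(* [is_min A m]: the minimum of A exists and equals m. *)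
Definition is_min (R : realType) (A : set R) (m : R) : Prop :=
  A m /\ lbound A m.

(* The reverse inequality of the library's [convex_function]. *)
Definition concave_function (R : numFieldType) (E : lmodType R)
    (E' := convex_lmodType E) (D : set E') (f : E' -> R^o) :=
  forall t : {i01 R},
    {in D &, forall x y : E', (f x <| t |> f y <= f (x <| t |> y))%R}.

Section RationalFunctions.
Variable R : realType.

(* Coefficients may be complex; real-rational transfer functions are a
   particular case. *)
Definition ratfun := {fraction {poly R[i]}}.

Definition rf_cst (c : R) : ratfun := ((c%:C)%:P)%:F.
Definition rf_s : ratfun := ('X)%:F.

(* [repr] picks an arbitrary representative n / d with d != 0; dividing by the
   gcd performs the cancellation, so the values below do not depend on it. *)
Definition rf_num (f : ratfun) : {poly R[i]} :=
  let: (n, d) := frac (repr f) in n %/ gcdp n d.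
Definition rf_den (f : ratfun) : {poly R[i]} :=
  let: (n, d) := frac (repr f) in d %/ gcdp n d.

Definition pole_free (f : ratfun) (a : R[i]) : Prop := (rf_den f).[a] != 0.
Definition rf_eval (a : R[i]) (f : ratfun) : R[i] :=
  (rf_num f).[a] / (rf_den f).[a].

End RationalFunctions.

Definition mx22 (T : Type) (a b c d : T) : 'M[T]_2 :=
  \matrix_(i, j) if i == 0 then (if j == 0 then a else b)
                 else (if j == 0 then c else d).

Section XZGraph.
Variables (R : realType) (n : nat).

(* The Euclidean norm (the library norm on matrices is the sup norm). *)
Definition cnorm (v : 'cV[R[i]]_n) : R :=
  Num.sqrt (\sum_i Normc.normc (v i ord0) ^+ 2).

Definition re_form (A : 'M[R[i]]_n) (v : 'cV[R[i]]_n) : R :=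
  complex.Re ((v^t* *m A *m v) ord0 ord0).

Definition xz_graph (A : 'M[R[i]]_n) : set (R * R) :=
  [set (re_form A v, cnorm (A *m v) ^+ 2) | v in [set v | cnorm v = 1]].

End XZGraph.

Section Converter.
Variable R : realType.

(* An operating point ((P, Q), V). *)
Definition opoint := ((R * R) * R)%type.

(* theta is an argument of P + jQ, up to multiples of 2 pi; every real is an
   argument of 0. *)
Definition is_angle (P Q theta : R) : Prop :=
  P = Num.sqrt (P ^+ 2 + Q ^+ 2) * cos theta /\
  Q = Num.sqrt (P ^+ 2 + Q ^+ 2) * sin theta.

Definition admissible (kappa : R) (Psi Vset : set R) : set opoint :=
  [set O : opoint |
    [/\ 0 < O.2,
        O.1.1 ^+ 2 + O.1.2 ^+ 2 <= kappa ^+ 2,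
        exists2 theta, Psi theta & is_angle O.1.1 O.1.2 theta &
        Vset O.2]].

Record converter := Converter {
  G_I : ratfun R;
  Y_VF : ratfun R;
  PI_AC : ratfun R;
  PI_RC : ratfun R;
  PI_VC : ratfun R;
  PI_PLL : ratfun R;
  C_F : R
}.

Inductive control_mode := PQ_mode | PV_mode.

Definition D_p (c : converter) (V : R) : ratfun R :=
  1 + G_I c * PI_AC c * rf_cst V.
Definition D_q (c : converter) (V : R) : ratfun R :=
  1 + G_I c * PI_RC c * rf_cst V.
Definition S_pll (c : converter) (V : R) : ratfun R :=
  rf_s R + PI_PLL c * rf_cst V.

Definition Y_F (omega0 : R) (c : converter) : 'M[ratfun R]_2 :=
  rf_cst (C_F c / omega0) *:
    mx22 (rf_s R) (- rf_cst omega0) (rf_cst omega0) (rf_s R).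

Definition Y_C (omega0 : R) (c : converter) (mode : control_mode)
    (O : opoint) : 'M[ratfun R]_2 :=
  let s := rf_s R in
  let P := rf_cst O.1.1 in
  let Q := rf_cst O.1.2 in
  let V := rf_cst O.2 in
  let Dp := D_p c O.2 in
  let Dq := D_q c O.2 in
  let S := S_pll c O.2 in
  let y11 := (G_I c * PI_AC c * P + V * Y_VF c) / (V * Dp) in
  let y12 := - (Q * (s * G_I c * PI_AC c + PI_PLL c * Dp) / (V * Dp * S)) in
  match mode with
  | PQ_mode =>
      mx22 y11 y12
        (- (Q * G_I c * PI_RC c / (V * Dq)))
        ((s * V * Y_VF c - P * (s * G_I c * PI_RC c + PI_PLL c * Dq))
           / (V * S * Dq))
  | PV_mode =>
      mx22 y11 y12
        (- (G_I c * PI_VC c))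
        ((s * V * Y_VF c - PI_PLL c * P) / (V * S))
  end + Y_F omega0 c.

(* Division by 0 returns 0 in a field, so the denominators of [Y_C] have to be
   required nonzero as rational functions; D_q occurs only in PQ mode. *)
Definition Y_C_well_defined (c : converter) (mode : control_mode) (V : R) :=
  [/\ D_p c V != 0, S_pll c V != 0 & mode = PQ_mode -> D_q c V != 0].

Definition jw (omega : R) : R[i] := 0 +i* omega.

(* No pole at j omega at voltage V, whatever P and Q; as the entries are affine
   in (P, Q), this says that their coefficients have no pole at j omega. *)
Definition Y_C_pole_free (omega0 : R) (c : converter) (mode : control_mode)
    (V omega : R) :=
  forall (P Q : R) (i j : 'I_2),
    pole_free (Y_C omega0 c mode ((P, Q), V) i j) (jw omega).

Definition Y_C_at (omega0 : R) (c : converter) (mode : control_mode)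
    (omega : R) (O : opoint) : 'M[R[i]]_2 :=
  map_mx (rf_eval (jw omega)) (Y_C omega0 c mode O).

Definition F_inv (omega0 eps : R) (s : R[i]) : 'M[R[i]]_2 :=
  mx22 (s / omega0%:C + eps%:C) (- 1) 1 (s / omega0%:C + eps%:C).

Definition loop (omega0 eps : R) (c : converter) (mode : control_mode)
    (omega : R) (O : opoint) : 'M[R[i]]_2 :=
  Y_C_at omega0 c mode omega O *m F_inv omega0 eps (jw omega).

(* Leftmost x-value of the x-z graph. *)
Definition x_low (omega0 eps : R) (c : converter) (mode : control_mode)
    (omega : R) (O : opoint) : R :=
  inf [set p.1 | p in xz_graph (loop omega0 eps c mode omega O)].

End Converter.

(* Main.v *)
From mathcomp Require Import ring.
Require Import Defs.

(* At fixed V the entries of Y_C are affine in (P, Q) over the rational functions;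
   since no value has a pole at j omega, evaluation there is additive and the loop
   matrix is affine in (P, Q) as well. For every unit v the real part of v* A v is
   thus affine in (P, Q), and x, a pointwise minimum of such functions, is
   concave. Joint continuity in (P, Q, v) and compactness of the unit sphere give
   a minimiser over U. If it is interior, follow a horizontal line through it in both
   directions until the last points of U: these lie on the boundary, and by concavity
   one of them has a value that is no larger. Hence the boundary minimum is the
   minimum over U, which decreases as U grows. *)

Import Order.TTheory GRing.Theory Num.Theory.
Import numFieldNormedType.Exports.

Local Open Scope classical_set_scope.
Local Open Scope ring_scope.
Local Open Scope convex_scope.

Set Implicit Arguments.
Unset Strict Implicit.

(** * Rational functions and their values at a point that is not a pole *)

Lemma fracE (K : idomainType) (f : {fraction K}) :
  f = FracField.tofrac (frac (repr f)).1 / FracField.tofrac (frac (repr f)).2.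
Proof.
rewrite -[LHS]reprK; move: (repr f) => x.
unlock FracField.tofrac.
rewrite -[X in _ * X]FracField.pi_inv -[RHS]FracField.pi_mul.
rewrite /FracField.mulf /FracField.invf /= !numden_Ratio ?oner_neq0 //.
  by rewrite mulr1 mul1r Ratio_numden.
all: by case: x.
Qed.

Lemma affine_at00 (K : pzRingType) (b0 b1 b2 : K) : b0 + 0 * b1 + 0 * b2 = b0.
Proof. by rewrite !mul0r !addr0. Qed.

Lemma affine_at10 (K : pzRingType) (b0 b1 b2 : K) : b0 + 1 * b1 + 0 * b2 = b0 + b1.
Proof. by rewrite mul1r mul0r addr0. Qed.

Lemma affine_at01 (K : pzRingType) (b0 b1 b2 : K) : b0 + 0 * b1 + 1 * b2 = b0 + b2.
Proof. by rewrite mul1r mul0r addr0. Qed.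

Section PoleFreeValues.
Variables (R : realType) (a : R[i]).
Implicit Types (f g : ratfun R) (u v : R[i]).

(* [rf_eval] reads off one chosen fraction; this relation allows any fraction
   regular at [a], which makes it compatible with the field operations. *)
Definition rf_val f v :=
  exists n d : {poly R[i]},
    [/\ f = FracField.tofrac n / FracField.tofrac d, d.[a] != 0 & v = n.[a] / d.[a]].

Lemma horner_neq0 (p : {poly R[i]}) : p.[a] != 0 -> p != 0.
Proof. by apply: contraNneq => ->; rewrite horner0. Qed.

(** Cross-multiplying turns equality of the two fractions into the polynomial identity
    [n * d' = n' * d], which can be evaluated at [a]. *)
Lemma rf_val_uniq f u v : rf_val f u -> rf_val f v -> u = v.
Proof.
move=> [n [d [-> d0 ->]]] [n' [d' [/eqP e d'0 ->]]]; apply/eqP.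
move: e; rewrite !eqr_div ?tofrac_eq0 ?horner_neq0 // -!tofracM tofrac_eq.
by move=> /eqP e; rewrite -!hornerM e.
Qed.

(** The gcd is nonzero because [d] is, so cancelling it does not change the fraction, and
    [pole_free] says that the reduced denominator does not vanish at [a]. *)
Lemma rf_val_eval f : pole_free f a -> rf_val f (rf_eval a f).
Proof.
rewrite /pole_free /rf_eval /rf_num /rf_den.
have := fracE f; case: (repr f) => -[n d] /= d0 fE pf.
exists (n %/ gcdp n d), (d %/ gcdp n d); split => //.
have g0 : gcdp n d != 0 by rewrite gcdp_eq0 negb_and d0 orbT.
have := divpK (dvdp_gcdr n d); have := divpK (dvdp_gcdl n d).
move: (gcdp n d) g0 fE => g g0 -> {1}<- {1}<-.
by rewrite !tofracM -mulf_div divff ?mulr1 // tofrac_eq0.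
Qed.

Lemma rf_cst0 : rf_cst (0 : R) = 0.
Proof. by rewrite /rf_cst !rmorph0. Qed.

Lemma rf_cst1 : rf_cst (1 : R) = 1.
Proof. by rewrite /rf_cst !rmorph1. Qed.

Lemma rf_val_cst (r : R) : rf_val (rf_cst r) r%:C%C.
Proof. by exists (r%:C%C%:P), 1; rewrite !hornerE tofrac1 !divr1 oner_neq0. Qed.

Lemma rf_valD f g u v : rf_val f u -> rf_val g v -> rf_val (f + g) (u + v).
Proof.
move=> [n [d [-> d0 ->]]] [n' [d' [-> d'0 ->]]].
exists (n * d' + n' * d), (d * d'); rewrite !hornerE mulf_neq0 //.
by rewrite !addf_div ?tofrac_eq0 ?horner_neq0 // tofracD !tofracM.
Qed.

Lemma rf_valM f g u v : rf_val f u -> rf_val g v -> rf_val (f * g) (u * v).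
Proof.
move=> [n [d [-> d0 ->]]] [n' [d' [-> d'0 ->]]].
exists (n * n'), (d * d'); rewrite !hornerM mulf_neq0 //.
by rewrite !mulf_div !tofracM.
Qed.

Lemma rf_valN f u : rf_val f u -> rf_val (- f) (- u).
Proof.
by move=> [n [d [-> d0 ->]]]; exists (- n), d; rewrite hornerN -!mulNr tofracN.
Qed.

End PoleFreeValues.

(** * Families of rational functions affine in the power injections *)

Section AffineFamilies.
Variable R : realType.
Implicit Types (y z : R -> R -> ratfun R) (k : ratfun R).

Definition rf_affine y :=
  exists b0 b1 b2, forall P Q : R, y P Q = b0 + rf_cst P * b1 + rf_cst Q * b2.

Lemma rf_affine_cst k : rf_affine (fun _ _ => k).
Proof. by exists k, 0, 0 => P Q; rewrite !mulr0 !addr0. Qed.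

Lemma rf_affine_P : rf_affine (fun P _ => rf_cst P).
Proof. by exists 0, 1, 0 => P Q; rewrite mulr0 mulr1 add0r addr0. Qed.

Lemma rf_affine_Q : rf_affine (fun _ Q => rf_cst Q).
Proof. by exists 0, 0, 1 => P Q; rewrite mulr0 mulr1 !add0r. Qed.

Lemma rf_affineD y z :
  rf_affine y -> rf_affine z -> rf_affine (fun P Q => y P Q + z P Q).
Proof.
move=> [b0 [b1 [b2 yE]]] [c0 [c1 [c2 zE]]].
exists (b0 + c0), (b1 + c1), (b2 + c2) => P Q.
by rewrite yE zE !mulrDr addrACA; congr (_ + _); rewrite addrACA.
Qed.

Lemma rf_affineMr y k : rf_affine y -> rf_affine (fun P Q => y P Q * k).
Proof.
move=> [b0 [b1 [b2 yE]]]; exists (b0 * k), (b1 * k), (b2 * k) => P Q.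
by rewrite yE !mulrDl !mulrA.
Qed.

Lemma rf_affineMl y k : rf_affine y -> rf_affine (fun P Q => k * y P Q).
Proof.
move=> /(rf_affineMr k) [b0 [b1 [b2 yE]]]; exists b0, b1, b2 => P Q.
by rewrite mulrC yE.
Qed.

Lemma rf_affineN y : rf_affine y -> rf_affine (fun P Q => - y P Q).
Proof.
move=> /(rf_affineMr (-1)) [b0 [b1 [b2 yE]]]; exists b0, b1, b2 => P Q.
by rewrite -yE mulrN1.
Qed.

(** Only the values [y P Q] are assumed regular at [a], not the coefficients. Writing the
    coefficients through the values at (0,0), (1,0) and (0,1) shows that they are regular too, so
    the affine identity survives evaluation. *)
Lemma rf_affine_eval y (a : R[i]) :
    rf_affine y -> (forall P Q, pole_free (y P Q) a) ->
  exists v0 v1 v2 : R[i], forall P Q,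
    rf_eval a (y P Q) = v0 + P%:C%C * v1 + Q%:C%C * v2.
Proof.
move=> [b0 [b1 [b2 yE]]] pf.
have yval P Q := rf_val_eval (pf P Q).
have y00 : y 0 0 = b0 by rewrite yE rf_cst0; exact: affine_at00.
have y10 : y 1 0 = b0 + b1 by rewrite yE rf_cst0 rf_cst1; exact: affine_at10.
have y01 : y 0 1 = b0 + b2 by rewrite yE rf_cst0 rf_cst1; exact: affine_at01.
have b1E : b1 = y 1 0 - y 0 0 by rewrite y10 y00 addrAC subrr add0r.
have b2E : b2 = y 0 1 - y 0 0 by rewrite y01 y00 addrAC subrr add0r.
exists (rf_eval a (y 0 0)), (rf_eval a (y 1 0) - rf_eval a (y 0 0)),
  (rf_eval a (y 0 1) - rf_eval a (y 0 0)) => P Q.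
apply: rf_val_uniq (yval P Q) _; rewrite yE b1E b2E -y00.
by do ?[apply: rf_valD | apply: rf_valM | apply: rf_valN | exact: rf_val_cst
  | exact: yval].
Qed.

(** The denominators depend on [V] and [s] only, and the numerators never multiply P and Q together,
    so sums and products with fixed factors produce every entry. *)
Lemma Y_C_affine omega0 (c : converter R) mode V (i j : 'I_2) :
  rf_affine (fun P Q => Y_C omega0 c mode ((P, Q), V) i j).
Proof.
rewrite /Y_C /=.
have addE (A B : R -> R -> 'M[ratfun R]_2) : rf_affine (fun P Q => A P Q i j) ->
  rf_affine (fun P Q => B P Q i j) -> rf_affine (fun P Q => (A P Q + B P Q) i j).
  move=> /rf_affineD h /h [b0 [b1 [b2 yE]]]; exists b0, b1, b2 => P Q.
  by rewrite mxE yE.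
apply: addE; last exact: rf_affine_cst.
have mx22E (a b d e : R -> R -> ratfun R) : rf_affine a -> rf_affine b ->
    rf_affine d -> rf_affine e ->
    rf_affine (fun P Q => mx22 (a P Q) (b P Q) (d P Q) (e P Q) i j).
  move=> [a0 [a1 [a2 aE]]] [b0 [b1 [b2 bE]]] [d0 [d1 [d2 dE]]] [e0 [e1 [e2 eE]]].
  exists (mx22 a0 b0 d0 e0 i j), (mx22 a1 b1 d1 e1 i j), (mx22 a2 b2 d2 e2 i j).
  by move=> P Q; rewrite !mxE; case: ifP; case: ifP.
case: mode; apply: mx22E.
all: do ?[exact: rf_affine_P | exact: rf_affine_Q | exact: rf_affine_cst
  | apply: rf_affineN | apply: rf_affineD | apply: rf_affineMr
  | apply: rf_affineMl].
Qed.

End AffineFamilies.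

Lemma is_min_inf (R : realType) (A : set R) (m : R) : is_min A m -> inf A = m.
Proof.
move=> [Am lbm]; apply/eqP; rewrite eq_le; apply/andP; split.
  by apply: ge_inf => //; exists m.
by apply: lb_le_inf => //; exists m.
Qed.

(** * Continuity of complex-valued maps *)

Section ComplexContinuity.
Variables (R : realType) (T : topologicalType).
Implicit Types f g : T -> R[i].

(** Working with real coordinates reduces every closure property to the real case. Both parts are
    tracked because the real part of a product involves the imaginary parts of its factors. *)
Definition ccontinuous f :=
  continuous (fun x => complex.Re (f x) : R^o) /\
  continuous (fun x => complex.Im (f x) : R^o).

Lemma ccontinuous_cst (c : R[i]) : ccontinuous (fun=> c).
Proof. by split => x; exact: cvg_cst. Qed.

Lemma ccontinuousD f g :
  ccontinuous f -> ccontinuous g -> ccontinuous (fun x => f x + g x).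
Proof.
move=> [fr fi] [gr gi]; split => x.
- under eq_fun do rewrite raddfD /=.
  exact: cvgD (fr x) (gr x).
- under eq_fun do rewrite raddfD /=.
  exact: cvgD (fi x) (gi x).
Qed.

Lemma ccontinuousM f g :
  ccontinuous f -> ccontinuous g -> ccontinuous (fun x => f x * g x).
Proof.
have ReM (a b : R[i]) : complex.Re (a * b) =
  complex.Re a * complex.Re b - complex.Im a * complex.Im b by case: a; case: b.
have ImM (a b : R[i]) : complex.Im (a * b) =
  complex.Re a * complex.Im b + complex.Im a * complex.Re b by case: a; case: b.
move=> [fr fi] [gr gi]; split => x.
- under eq_fun do rewrite ReM.
  by apply: cvgB; apply: cvgM; [exact: fr|exact: gr|exact: fi|exact: gi].
- under eq_fun do rewrite ImM.
  by apply: cvgD; apply: cvgM; [exact: fr|exact: gi|exact: fi|exact: gr].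
Qed.

Lemma ccontinuous_conj f : ccontinuous f -> ccontinuous (fun x => Num.conj (f x)).
Proof.
have ReC (a : R[i]) : complex.Re (Num.conj a) = complex.Re a by case: a.
have ImC (a : R[i]) : complex.Im (Num.conj a) = - complex.Im a by case: a.
move=> [fr fi]; split => x.
- under eq_fun do rewrite ReC.
  exact: fr.
- under eq_fun do rewrite ImC.
  apply: cvgN; exact: fi.
Qed.

Lemma ccontinuous_sum (I : Type) (r : seq I) (F : I -> T -> R[i]) :
  (forall i, ccontinuous (F i)) -> ccontinuous (fun x => \sum_(i <- r) F i x).
Proof.
move=> cF; elim: r => [|i r IH].
  by under eq_fun do rewrite big_nil; exact: ccontinuous_cst.
under eq_fun do rewrite big_cons.
exact: ccontinuousD.
Qed.

End ComplexContinuity.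

(** * Compactness of the complex unit sphere and attainment of the minimum *)

Section UnitSphere.
Variables (R : realType) (n : nat).
Local Notation rV := 'rV[R^o]_n.+1.

(* Real coordinates on C^n, in which closed bounded sets are known to be
   compact. *)
Definition cvec (w : rV * rV) : 'cV[R[i]]_n.+1 :=
  \col_i Complex (w.1 ord0 i) (w.2 ord0 i).

Lemma cvec_surj v : exists w, cvec w = v.
Proof.
exists (\row_i complex.Re (v i ord0), \row_i complex.Im (v i ord0)).
by apply/colP => i; rewrite !mxE; case: (v i ord0).
Qed.

Lemma cnorm_cvec (w : rV * rV) :
  cnorm (cvec w) = Num.sqrt (\sum_i (w.1 ord0 i ^+ 2 + w.2 ord0 i ^+ 2)).
Proof.
congr Num.sqrt; apply: eq_bigr => i _; rewrite mxE /= sqr_sqrtr //.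
by rewrite addr_ge0 // sqr_ge0.
Qed.

Lemma cvec_continuous i : ccontinuous (fun w : rV * rV => cvec w i ord0).
Proof.
split => w; under eq_fun do rewrite mxE /=.
  apply: (cvg_comp fst (fun u : rV => u ord0 i)); first exact: cvg_fst.
  exact: coord_continuous.
apply: (cvg_comp snd (fun u : rV => u ord0 i)); first exact: cvg_snd.
exact: coord_continuous.
Qed.

Lemma compact_cvec_sphere : compact [set w : rV * rV | cnorm (cvec w) = 1].
Proof.
pose box := [set u : rV | forall i, `[(-1 : R), 1]%classic (u ord0 i)].
have cbox : compact box.
  by apply: (@rV_compact _ _ (fun=> `[(-1 : R), 1]%classic)) => _; exact: segment_compact.
apply: (@subclosed_compact _ _ (box `*` box)).
- have -> : [set w : rV * rV | cnorm (cvec w) = 1] =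
      (fun w => cnorm (cvec w)) @^-1` [set 1] by [].
  apply: preimage_closed; last first.
    exact/accessible_closed_set1/hausdorff_accessible/(@norm_hausdorff _ R^o).
  move=> w _.
  (* The squared norm is the real part of the sum of the [v_i * conj v_i], which brings its
     continuity under the complex closure lemmas. *)
  have normE (u : rV * rV) : cnorm (cvec u) = Num.sqrt
      (complex.Re (\sum_i cvec u i ord0 * Num.conj (cvec u i ord0))).
    rewrite cnorm_cvec raddf_sum; congr Num.sqrt; apply: eq_bigr => i _.
    by rewrite mxE /= mulrN opprK -!expr2.
  under eq_fun do rewrite normE.
  apply: (cvg_comp _ Num.sqrt); last exact: sqrt_continuous.
  have [|cR _] := @ccontinuous_sum _ _ _ (index_enum 'I_n.+1)
    (fun i (w : rV * rV) => cvec w i ord0 * Num.conj (cvec w i ord0)).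
  by move=> i; apply: ccontinuousM; [|apply: ccontinuous_conj];
    exact: cvec_continuous.
  exact: cR.
- exact: compact_setX.
- move=> w /=; rewrite cnorm_cvec => /(congr1 (fun r => r ^+ 2)).
  rewrite expr1n sqr_sqrtr; last first.
    by apply: sumr_ge0 => i _; rewrite addr_ge0 // sqr_ge0.
  move=> w1.
  (* Each squared coordinate is at most the total, which is 1; hence all coordinates lie in
     [-1, 1]. *)
  have le1 i : w.1 ord0 i ^+ 2 + w.2 ord0 i ^+ 2 <= 1.
    rewrite -w1 (bigD1 i) //= lerDl; apply: sumr_ge0 => j _.
    by rewrite addr_ge0 // sqr_ge0.
  split => i; rewrite /= in_itv /= -ler_norml -(@ler_pXn2r _ 2) ?nnegrE ?ler01 //
    expr1n real_normK ?num_real //; apply: le_trans (le1 i).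
    by rewrite lerDl sqr_ge0.
  by rewrite lerDr sqr_ge0.
Qed.

(* Minimising jointly over U and the unit sphere yields the minimum over U of the
   smallest form value without proving that this value is continuous in p. *)
Lemma re_form_min (T : topologicalType) (A : T -> 'M[R[i]]_n.+1) (U : set T) :
    (forall i j, ccontinuous (fun p => A p i j)) -> U !=set0 -> compact U ->
  exists p v, [/\ U p, cnorm v = 1 &
    forall p' v', U p' -> cnorm v' = 1 -> re_form (A p) v <= re_form (A p') v'].
Proof.
move=> cA [p0 Up0] cU.
pose S := [set w : rV * rV | cnorm (cvec w) = 1].
have S0 : S !=set0.
  (* The first basis vector, available because the dimension is [n.+1], shows that the sphere is
     nonempty. *)
  have [w wE] := cvec_surj (delta_mx ord0 ord0); exists w.
  rewrite /S /= wE /cnorm big_ord_recl mxE !eqxx /= big1 => [|i _].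
    by rewrite addr0 expr0n addr0 expr1n sqrtr1 expr1n sqrtr1.
  by rewrite mxE /= expr0n addr0 sqrtr0 expr0n.
pose h (pw : T * (rV * rV)) : R := re_form (A pw.1) (cvec pw.2).
have ch : continuous h.
  have cA' i j : ccontinuous (fun pw : T * (rV * rV) => A pw.1 i j).
    have [cr ci] := cA i j; split => x.
      apply: (cvg_comp fst (fun p => complex.Re (A p i j) : R^o));
        [exact: cvg_fst|exact: cr].
    apply: (cvg_comp fst (fun p => complex.Im (A p i j) : R^o));
        [exact: cvg_fst|exact: ci].
  have cv i : ccontinuous (fun pw : T * (rV * rV) => cvec pw.2 i ord0).
    have [cr ci] := cvec_continuous i; split => x.
      apply: (cvg_comp snd (fun w => complex.Re (cvec w i ord0) : R^o));
        [exact: cvg_snd|exact: cr].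
    apply: (cvg_comp snd (fun w => complex.Im (cvec w i ord0) : R^o));
        [exact: cvg_snd|exact: ci].
  suff [] : ccontinuous (fun pw : T * (rV * rV) =>
    ((cvec pw.2 ^t*)%sesqui *m A pw.1 *m cvec pw.2) ord0 ord0) by [].
  under eq_fun do rewrite mxE.
  apply: ccontinuous_sum => j; apply: ccontinuousM => //.
  under eq_fun do rewrite mxE.
  apply: ccontinuous_sum => k; apply: ccontinuousM => //.
  under eq_fun do rewrite mxE mxE.
  exact: ccontinuous_conj (cv k).
have [] := @compact_EVT_min _ _ h (U `*` S).
- by have [w Sw] := S0; exists (p0, w).
- by apply: compact_setX => //; exact: compact_cvec_sphere.
- exact: continuous_subspaceT.
move=> [p w] /set_mem[/= Up Sw] hmin; exists p, (cvec w); split => // p' v' Up' v'1.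
have [w' w'E] := cvec_surj v'.
rewrite -w'E; apply: (hmin (p', w')); apply/mem_set; split => //=.
by rewrite /S /= w'E.
Qed.

End UnitSphere.

(** * Concave functions on compact planar sets *)

Section BoundaryMinimum.
Variable R : realType.
Implicit Types (U : set (R^o * R^o)) (p q : R^o * R^o).

Lemma boundary_subset (T : topologicalType) (A : set T) :
  hausdorff_space T -> compact A -> boundary A `<=` A.
Proof.
by move=> hT cA x [+ _]; rewrite -(iffLR (closure_id _)) //; exact: compact_closed.
Qed.

(* The witness is the extreme point, in direction s, of the horizontal slice of U
   through p. *)
Lemma horizontal_boundary_point U p (s : R) : compact U -> U p -> `|s| = 1 ->
  exists q, [/\ boundary U q, q.2 = p.2 & s * p.1 <= s * q.1].
Proof.
move=> cU Up s1; pose L := [set q : R^o * R^o | q.2 = p.2].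
have cUL : compact (U `&` L).
  apply: compact_closedI => //.
  by apply: (@preimage_closed _ _ snd [set p.2]); [move=> ? _; exact: cvg_snd|
    exact/accessible_closed_set1/hausdorff_accessible/(@norm_hausdorff _ R^o)].
have [] := @compact_EVT_max _ _ (fun q : R^o * R^o => s * q.1) _ _ cUL.
- by exists p.
- apply: continuous_subspaceT => q; apply: cvgMr; exact: cvg_fst.
move=> q /set_mem[Uq Lq] qmax; exists q; split => //; last exact/qmax/mem_set.
split; first exact: subset_closure.
rewrite /interior => /nbhs_ballP[e /= e0 qe].
have s2 : s * s = 1 by rewrite -expr2 -real_normK ?num_real // s1 expr1n.
(* If a ball of radius [e] around [q] lay in U, moving [q] by [e / 2] in direction [s] would stay in
   U and on the line. As [s * s = 1], this raises [s * q.1] by [e / 2], against maximality. *)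
pose q' : R^o * R^o := (q.1 + s * (e / 2), q.2).
have Uq' : U q'.
  apply: qe; split; last exact: ballxx.
  rewrite /= -ball_normE /= opprD addrA subrr add0r normrN normrM s1 mul1r.
  by rewrite gtr0_norm ?divr_gt0 // ltr_pdivrMr // mulr_natr mulr2n ltrDl.
have := qmax q' (mem_set (conj Uq' Lq)).
by rewrite /= mulrDr mulrA s2 mul1r gerDl leNgt divr_gt0.
Qed.

Lemma concave_le_boundary (x : R^o * R^o -> R^o) U p :
    concave_function setT x -> compact U -> U p ->
  exists2 q, boundary U q & x q <= x p.
Proof.
move=> xconc cU Up.
have [q [bq q2 pq]] := horizontal_boundary_point cU Up (normr1 R).
have [r [br r2 rp]] := horizontal_boundary_point cU Up (normrN1 R).
rewrite !mul1r in pq; rewrite !mulN1r lerN2 in rp.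
(* If [p] is the right end, it is itself a boundary point. Otherwise the two ends are distinct and
   the division defining [t] is legitimate. *)
have [->|qr] := eqVneq p q; first by exists q.
have rq : r.1 < q.1.
  rewrite lt_neqAle (le_trans rp pq) andbT; apply: contraNneq qr => e.
  apply/eqP/injective_projections => //.
  by apply/eqP; rewrite eq_le pq -e rp.
(* The weight for which [p] equals [t * q + (1 - t) * r]. *)
pose t := (p.1 - r.1) / (q.1 - r.1).
have t0 : 0 <= t by rewrite divr_ge0 // subr_ge0 // ltW.
have t1 : t <= 1 by rewrite ler_pdivrMr ?subr_gt0 // mul1r lerD2r.
have := xconc (Itv01 t0 t1) q r (mem_set I) (mem_set I).
have -> : ((q : convex_lmodType (R^o * R^o)%type) <| Itv01 t0 t1 |> r) = p.
  apply: injective_projections.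
    transitivity (t * q.1 + (1 - t) * r.1); first by [].
    by rewrite /t; field; rewrite subr_eq0 gt_eqF.
  transitivity (t * q.2 + (1 - t) * r.2); first by [].
  by rewrite q2 r2 -mulrDl addrC subrK mul1r.
rewrite convRE /= /unstable.onem => h.
have t1' : 0 <= 1 - t by rewrite subr_ge0.
have avgl (m a b : R) : m <= a -> m <= b -> m <= t * a + (1 - t) * b.
  move=> ma mb; have -> : m = t * m + (1 - t) * m by rewrite -mulrDl addrC subrK mul1r.
  by rewrite lerD // ler_wpM2l.
(* By concavity [x p] is at least a weighted average of [x q] and [x r], hence at least the smaller
   of them. *)
by have [qr'|/ltW rq'] := leP (x q) (x r); [exists q|exists r] => //;
  apply: le_trans h; apply: avgl.
Qed.

End BoundaryMinimum.

(** * Linearity of the real quadratic form in the matrix *)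

Section ReForm.
Variables (R : realType) (n : nat).
Implicit Types (A B : 'M[R[i]]_n) (v : 'cV[R[i]]_n).

Lemma re_formD A B v : re_form (A + B) v = re_form A v + re_form B v.
Proof. by rewrite /re_form mulmxDr mulmxDl mxE raddfD. Qed.

(** The scalar is real because a complex one would mix real and imaginary parts; the scalars that
    occur are P, Q and nothing else. *)
Lemma re_formZ (r : R) A v : re_form (r%:C%C *: A) v = r * re_form A v.
Proof.
rewrite /re_form -scalemxAr -scalemxAl mxE.
by case: (_ ord0 ord0) => a b /=; rewrite mul0r subr0.
Qed.

Lemma xz_graph_fst A :
  [set p.1 | p in xz_graph A] = [set re_form A v | v in [set v | cnorm v = 1]].
Proof. exact: image_comp. Qed.

End ReForm.

(** The boundary is contained in the compact set U, so [x p] bounds its values from below; a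
    boundary point with value at most [x p] then attains it exactly. *)
Lemma concave_is_min_boundary (R : realType) (x : R^o * R^o -> R^o)
    (U : set (R^o * R^o)) (p : R^o * R^o) :
    concave_function setT x -> compact U -> U p ->
    (forall q, U q -> x p <= x q) ->
  is_min (x @` U) (x p) /\ is_min (x @` boundary U) (x p).
Proof.
move=> xconc cU Up pmin.
have lbU : lbound (x @` U) (x p) by move=> _ [q Uq <-]; exact: pmin.
have bU : boundary U `<=` U.
  by apply: boundary_subset cU; exact: norm_hausdorff.
split; first by split => //; exists p.
split; last by move=> _ [q /bU Uq <-]; exact: pmin.
have [q bq qp] := concave_le_boundary xconc cU Up.
by exists q => //; apply/eqP; rewrite eq_le qp pmin //; exact: bU.
Qed.

(** * The leftmost value of the graph as a function of the power injections *)

Section LeftmostValue.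
Variables (R : realType) (omega0 eps : R) (c : converter R).
Variables (mode : control_mode) (V omega : R).
Local Notation loopV p := (loop omega0 eps c mode omega (p, V)).
Local Notation xV p := (x_low omega0 eps c mode omega (p, V)).

Lemma loop_affine : Y_C_pole_free omega0 c mode V omega ->
  exists A0 A1 A2 : 'M[R[i]]_2, forall p : R * R,
    loopV p = A0 + p.1%:C%C *: A1 + p.2%:C%C *: A2.
Proof.
move=> Ypf.
(* Collects the coefficients of all entries into three matrices. The factor [F_inv] is independent
   of (P, Q), so multiplying by it keeps the family affine. *)
have /choice[B BE] (ij : 'I_2 * 'I_2) : exists b : R[i] * R[i] * R[i], forall P Q,
    rf_eval (jw omega) (Y_C omega0 c mode ((P, Q), V) ij.1 ij.2) =
    b.1.1 + P%:C%C * b.1.2 + Q%:C%C * b.2.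
  have [b0 [b1 [b2 bE]]] := rf_affine_eval (Y_C_affine omega0 c mode V ij.1 ij.2)
    (fun P Q => Ypf P Q ij.1 ij.2).
  by exists (b0, b1, b2).
exists (\matrix_(i, j) (B (i, j)).1.1 *m F_inv omega0 eps (jw omega)),
  (\matrix_(i, j) (B (i, j)).1.2 *m F_inv omega0 eps (jw omega)),
  (\matrix_(i, j) (B (i, j)).2 *m F_inv omega0 eps (jw omega)) => -[P Q].
rewrite !scalemxAl -!mulmxDl /loop; congr (_ *m _).
by apply/matrixP => i j; rewrite [LHS]mxE (BE (i, j)) !mxE.
Qed.

Hypothesis Ypf : Y_C_pole_free omega0 c mode V omega.

Lemma x_low_attained_on (U : set (R^o * R^o)) : U !=set0 -> compact U ->
  exists p v, [/\ U p, cnorm v = 1 &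
    forall p' v', U p' -> cnorm v' = 1 -> re_form (loopV p) v <= re_form (loopV p') v'].
Proof.
move=> U0 cU; apply: (@re_form_min _ 1 _ (fun p : R^o * R^o => loopV p)) => // i j.
have [A0 [A1 [A2 AE]]] := loop_affine Ypf.
have c1 : ccontinuous (fun p : R^o * R^o => p.1%:C%C).
  by split => p; [exact: cvg_fst|exact: cvg_cst].
have c2 : ccontinuous (fun p : R^o * R^o => p.2%:C%C).
  by split => p; [exact: cvg_snd|exact: cvg_cst].
under eq_fun do rewrite AE !mxE.
apply: ccontinuousD; first apply: ccontinuousD.
- exact: ccontinuous_cst.
- by apply: ccontinuousM; [exact: c1|exact: ccontinuous_cst].
- by apply: ccontinuousM; [exact: c2|exact: ccontinuous_cst].
Qed.

Lemma x_low_is_min (p : R * R) :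
  is_min [set re_form (loopV p) v | v in [set v | cnorm v = 1]] (xV p).
Proof.
(* On the singleton [[set p]] the joint minimisation over points and unit vectors reduces to the one
   over unit vectors at [p]. *)
have [_ [v [-> v1 vmin]]] := @x_low_attained_on [set p] (ex_intro _ p erefl)
  (@compact_set1 _ p).
have m : is_min [set re_form (loopV p) v | v in [set v | cnorm v = 1]]
    (re_form (loopV p) v).
  by split=> [|_ [v' v'1 <-]]; [exists v|exact: vmin].
by rewrite /x_low xz_graph_fst (is_min_inf m).
Qed.

(** A unit vector [v] attaining the minimum at the combination [r] has there the same combination of
    its form values at [p] and [q], each at least the minimum at that point. *)
Lemma x_low_concave : concave_function setT (fun p : R^o * R^o => xV p).
Proof.
move=> t p q _ _; set r := p <| t |> q.
have [[v v1 <-] _] := x_low_is_min r.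
have -> : re_form (loopV r) v =
    t%:num * re_form (loopV p) v + (1 - t%:num) * re_form (loopV q) v.
  have [A0 [A1 [A2 AE]]] := loop_affine Ypf.
  rewrite AE (AE p) (AE q) !(re_formD, re_formZ).
  have -> : r.1 = t%:num * p.1 + (1 - t%:num) * q.1 by [].
  have -> : r.2 = t%:num * p.2 + (1 - t%:num) * q.2 by [].
  have interp (u a0 a1 a2 p1 p2 q1 q2 : R) :
    a0 + (u * p1 + (1 - u) * q1) * a1 + (u * p2 + (1 - u) * q2) * a2 =
    u * (a0 + p1 * a1 + p2 * a2) + (1 - u) * (a0 + q1 * a1 + q2 * a2) by ring.
  exact: interp.
have le_form (u : R * R) : xV u <= re_form (loopV u) v.
  by have [_] := x_low_is_min u; apply; exists v.
rewrite convRE /= /unstable.onem.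
by apply: lerD; apply: ler_wpM2l; rewrite ?subr_ge0.
Qed.

(** The point of a joint minimiser minimises the leftmost value: at any [q] in U that value is
    attained by some unit [w], whose form value is no smaller than the joint minimum. *)
Lemma x_low_min_boundary (U : set (R^o * R^o)) : U !=set0 -> compact U ->
  exists m, is_min [set xV p | p in U] m /\ is_min [set xV p | p in boundary U] m.
Proof.
move=> U0 cU; have [p [v [Up v1 vmin]]] := x_low_attained_on U0 cU.
have pmin q : U q -> xV p <= xV q.
  move=> Uq; have [[w w1 <-] _] := x_low_is_min q.
  apply: le_trans (vmin _ _ Uq w1).
  by have [_] := x_low_is_min p; apply; exists v.
exists (xV p); exact: concave_is_min_boundary x_low_concave cU Up pmin.
Qed.

End LeftmostValue.

Theorem mainTheorem3 (R : realType) (omega0 eps : R) (c : converter R)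
    (mode : control_mode) (V omega : R)
    (omega0_gt0 : 0 < omega0) (V_gt0 : 0 < V) (omega_ge0 : 0 <= omega)
    (Ywd : Y_C_well_defined c mode V)
    (Ypf : Y_C_pole_free omega0 c mode V omega) :
  let x := fun PQ : R^o * R^o => x_low omega0 eps c mode omega (PQ, V) in
  [/\ (* the minimum defining x is attained, in both of its forms *)
      forall PQ : R^o * R^o,
        let A := loop omega0 eps c mode omega (PQ, V) in
        is_min [set p.1 | p in xz_graph A] (x PQ) /\
        is_min [set re_form A v | v in [set v | cnorm v = 1]] (x PQ),
      concave_function setT x,
      forall (kappa : R) (Psi Vset : set R) (U : set (R^o * R^o)),
        U !=set0 -> compact U ->
        U `*` [set V] `<=` admissible kappa Psi Vset ->
        exists m, is_min (x @` U) m /\ is_min (x @` boundary U) m &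
      forall U : R -> set (R^o * R^o),
        (forall rho : R, 0 <= rho -> U rho !=set0 /\ compact (U rho)) ->
        (forall rho1 rho2 : R, 0 <= rho1 -> rho1 < rho2 -> U rho1 `<=` U rho2) ->
        forall rho1 rho2 : R, 0 <= rho1 -> rho1 < rho2 ->
          exists m1 m2, [/\ is_min (x @` boundary (U rho1)) m1,
                            is_min (x @` boundary (U rho2)) m2 &
                            m2 <= m1]].
Proof.
move=> x; split.
- by move=> PQ A; rewrite xz_graph_fst; split; exact: x_low_is_min.
- exact: x_low_concave.
- by move=> _ _ _ U U0 cU _; exact: x_low_min_boundary.
move=> U Uc Umono rho1 rho2 rho1_ge0 rho12.
have [U10 cU1] := Uc _ rho1_ge0.
have [U20 cU2] := Uc _ (ltW (le_lt_trans rho1_ge0 rho12)).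
have [m1 [[[p Up <-] _] bm1]] := x_low_min_boundary eps Ypf U10 cU1.
have [m2 [[_ lb2] bm2]] := x_low_min_boundary eps Ypf U20 cU2.
(* [m2] is also the minimum over the whole of [U rho2], which contains the minimiser [p] of the
   smaller region. *)
exists (x p), m2; split => //; apply: lb2; exists p => //.
exact: Umono rho1_ge0 rho12 _ Up.
Qed.
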